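(* For each $n\in\mathbb N$ let $\mathcal A^{(n)}=\{A_i^{(n)}:i\in I_n\}$ be a collection of sets from $\mathcal K^d_0\setminus\{\{0\}\}$ such that $\mu_n=\sum_{i\in I_n}\delta_{A_i^{(n)}}$ is locally finite, and let $\mathcal A=\{A_i:i\in I\}\subset\mathcal K^d_0\setminus\{\{0\}\}$ be such that $\mu=\sum_{i\in I}\delta_{A_i}$ is locally finite. Assume that $\mu_n\to\mu$ vaguely as $n\to\infty$. Fix $m\in\mathbb N$ and suppose that: 1. all atoms of $\mu_n$ are strictly convex and regular, for all sufficiently large $n\in\mathbb N$; 2. the family $\mathcal A$ is in general position cofinitely; 3. $0\in\operatorname{Int}\mathrm{conv}(\mathcal A\setminus F)$ for every finite set $F\subset\mathcal A$. Then $\mathrm{conv}^{[m]}(\mathcal A^{(n)})\to\mathrm{conv}^{[m]}(\mathcal A)$ in the Hausdorff metric, as $n\to\infty$.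
   Context: **Spaces and vague convergence.** $\mathcal K^d_0$ is the family of compact convex sets in $\mathbb R^d$ containing the origin, with the Hausdorff metric $d_H$. A Borel measure $\mu$ on $\mathcal K^d_0\setminus\{\{0\}\}$ is locally finite if $\mu(\{A:\sup_{x\in A}\|x\|\ge r\})<\infty$ for all $r>0$. Locally finite measures $\mu_n$ converge vaguely to a locally finite $\mu$ if $\int f\,d\mu_n\to\int f\,d\mu$ for every bounded $d_H$-continuous $f:\mathcal K^d_0\setminus\{\{0\}\}\to\mathbb R$ vanishing in a Hausdorff neighbourhood of $\{0\}$. **Regularity.** A compact convex set $L$ is regular if its normal cone $N(L,x)$ is one-dimensional for every $x\in\partial L$. **Families.** Families consist of pairwise distinct sets. For a family $\mathcal L=\{L_i:i\in I\}$ of compact convex sets, $\mathrm{conv}(\mathcal L)$ and $\overline{\mathrm{conv}}(\mathcal L)$ are the convex hull and closed convex hull of $\bigcup_{i\in I}L_i$; $\dim$ is the affine dimension. **General position.** An exposed face of a compact convex set $C$ is a set $C\cap H$ with $H$ a supporting hyperplane of $C$. A family $\mathcal L$ with compact $\mathrm{conv}(\mathcal L)$ is in general position if, for each closed convex subset $A$ of each exposed face of $\mathrm{conv}(\mathcal L)$, the family $\mathcal M(\mathcal L,A)=\{L\in\mathcal L:L\cap A\ne\varnothing\}$ is finite and $\sum_{L\in\mathcal M(\mathcal L,A)}(1+\dim(A\cap L))\le\dim(A)+1$. A family $\mathcal L=\{L_i:i\in I\}$ with $\mathrm{conv}(\mathcal L)$ compact and of positive dimension is in general position cofinitely if for every finite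 $F\subset I$ the family $\{L_i:i\in I\setminus F\}$ is in general position (in particular has compact convex hull). **$m$-point peeling.** For a family $\mathcal L=\{L_i:i\in I\}$ and $0\le m<|I|\le\infty$, $$\mathrm{conv}^{[m]}(\mathcal L)=\bigcap_{J\subset I,\,|J|=m}\overline{\mathrm{conv}}\Bigl(\bigcup_{i\in I\setminus J}L_i\Bigr).$$ *)

(* Defs.v *)
(* The library topology of ['rV[R]_d] comes from the sup norm and coincides with
   the Euclidean one; everything metric below uses the Euclidean norm [enorm]. *)
From HB Require Import structures.
From mathcomp Require Import all_boot all_order all_algebra.
From mathcomp Require Import all_classical all_reals all_analysis.
From mathcomp Require Import ring lra.

Set Implicit Arguments.
Unset Strict Implicit.
Unset Printing Implicit Defensive.

Import Order.TTheory GRing.Theory Num.Theory.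
Import numFieldNormedType.Exports.

Local Open Scope classical_set_scope.
Local Open Scope card_scope.
Local Open Scope ring_scope.

Section euclidean.
Context {R : realType} {d : nat}.
Implicit Types (u v x y : 'rV[R]_d) (S C L H : set 'rV[R]_d).

Definition dotv u v : R := \sum_(i < d) u 0 i * v 0 i.

Definition enorm u : R := Num.sqrt (dotv u u).

(* Extended-real valued, so that it makes sense for arbitrary sets: it is +oo
   between the empty set and a nonempty one. *)
Definition hausdorff_dist S C : \bar R :=
  maxe (ereal_sup [set ereal_inf [set (enorm (x - y))%:E | y in C] | x in S])
       (ereal_sup [set ereal_inf [set (enorm (x - y))%:E | y in S] | x in C]).

Definition conv_hull S : set 'rV[R]_d :=
  smallest (@convex_set R 'rV[R]_d) S.

Definition closed_conv_hull S : set 'rV[R]_d :=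
  smallest [set C | closed C /\ @convex_set R 'rV[R]_d C] S.

(* the smallest linear subspace containing S; see [lin_spanP] *)
Definition lin_span S : {vspace 'rV[R]_d} :=
  xget fullv [set V : {vspace 'rV[R]_d} | S `<=` [set x | x \in V] /\
    forall W : {vspace 'rV[R]_d}, S `<=` [set x | x \in W] -> (V <= W)%VS].

(* dimension of the affine hull, -1 for the empty set *)
Definition affdim S : int :=
  if S == set0 then -1
  else (\dim (lin_span [set x - y | x in S & y in S]))%:Z.

Definition boundary S : set 'rV[R]_d := closure S `\` S°.

Definition normal_cone L x : set 'rV[R]_d :=
  [set u | forall y, L y -> dotv u (y - x) <= 0].

Definition regular_body L : Prop :=
  forall x, boundary L x -> affdim (normal_cone L x) = 1.

Definition strictly_convex L : Prop :=
  forall x y (t : R), L x -> L y -> x != y -> 0 < t < 1 ->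
    L° (t *: x + (1 - t) *: y).

Definition supporting_hyperplane C H : Prop :=
  exists u (c : R), [/\ u != 0, H = [set x | dotv u x = c],
    (forall x, C x -> dotv u x <= c) & C `&` H !=set0].

Definition exposed_face C S : Prop :=
  exists2 H, supporting_hyperplane C H & S = C `&` H.

End euclidean.

(* A subfamily of [L : I -> set 'rV[R]_d] is given by its set [D] of indices. *)
Section families.
Context {R : realType} {d : nat} {I : choiceType}.
Implicit Types (D F J : set I) (L : I -> set 'rV[R]_d).

Definition fam_conv D L : set 'rV[R]_d := conv_hull (\bigcup_(i in D) L i).

Definition fam_meeting D L (A : set 'rV[R]_d) : set I :=
  [set i | D i /\ L i `&` A !=set0].

Definition general_position D L : Prop :=
  compact (fam_conv D L) /\
  forall E A : set 'rV[R]_d, exposed_face (fam_conv D L) E ->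
    closed A -> @convex_set R 'rV[R]_d A -> A `<=` E ->
    finite_set (fam_meeting D L A) /\
    \sum_(i \in fam_meeting D L A) (1 + affdim (A `&` L i)) <= affdim A + 1.

Definition general_position_cofinitely D L : Prop :=
  [/\ compact (fam_conv D L), 0 < affdim (fam_conv D L)
    & forall F, finite_set F -> F `<=` D -> general_position (D `\` F) L].

(* meaningful when D has more than m elements *)
Definition peeling (m : nat) D L : set 'rV[R]_d :=
  \bigcap_(J in [set J | J `<=` D /\ J #= `I_m])
    closed_conv_hull (\bigcup_(i in D `\` J) L i).

End families.

(* compact convex sets containing the origin; [body] excludes {0} *)
Definition convex_body0 {R : realType} {d : nat} (A : set 'rV[R]_d) : Prop :=
  [/\ compact A, @convex_set R 'rV[R]_d A & A 0].

Record body (R : realType) (d : nat) := Body {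
  body_set :> set 'rV[R]_d ;
  body_convex_body0 : convex_body0 body_set ;
  body_neq0 : body_set <> [set 0] }.

HB.instance Definition _ (R : realType) (d : nat) := gen_eqMixin (body R d).
HB.instance Definition _ (R : realType) (d : nat) := gen_choiceMixin (body R d).

Section lin_span_lemmas.
Context {R : realType} {d : nat}.

Lemma lin_spanP (S : set 'rV[R]_d) :
  S `<=` [set x | x \in lin_span S] /\
  forall W : {vspace 'rV[R]_d}, S `<=` [set x | x \in W] ->
    (lin_span S <= W)%VS.
Proof.
rewrite /lin_span; set Q := (X in xget _ X).
suff : Q (xget fullv Q) by [].
apply: xgetPex.
pose P n := `[< exists V : {vspace 'rV[R]_d},
  S `<=` [set x | x \in V] /\ \dim V = n >].
have exP : exists n, P n.
  exists (\dim {: 'rV[R]_d})%VS; apply/asboolP; exists fullv; split => // x _.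
  exact: memvf.
case: (ex_minnP exP) => n /asboolP[V [SV dV]] minV.
exists V; split => // W SW.
have /minV : P (\dim (V :&: W)).
  apply/asboolP; exists (V :&: W)%VS; split => // x Sx /=.
  by rewrite memv_cap (SV x Sx) (SW x Sx).
rewrite -dV => dVW.
have /eqP <- : (V :&: W == V)%VS by rewrite eqEdim capvSl.
exact: capvSr.
Qed.

End lin_span_lemmas.

Section enorm_lemmas.
Context {R : realType} {d : nat}.
Implicit Types u v w x y : 'rV[R]_d.

Lemma dotv_ge0 u : 0 <= dotv u u.
Proof. by apply: sumr_ge0 => i _; rewrite -expr2 sqr_ge0. Qed.

Lemma enorm_ge0 u : 0 <= enorm u. Proof. exact: sqrtr_ge0. Qed.

Lemma enorm0 : enorm (0 : 'rV[R]_d) = 0.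
Proof. by rewrite /enorm /dotv big1 ?sqrtr0// => i _; rewrite mxE mul0r. Qed.

Lemma enormN u : enorm (- u) = enorm u.
Proof. by congr Num.sqrt; apply: eq_bigr => i _; rewrite !mxE mulrNN. Qed.

Lemma enormC x y : enorm (x - y) = enorm (y - x).
Proof. by rewrite -enormN opprB. Qed.

Lemma dotv_comb (a b : R) u v : dotv (a *: u + b *: v) (a *: u + b *: v) =
  a ^+ 2 * dotv u u + (a * b *+ 2) * dotv u v + b ^+ 2 * dotv v v.
Proof.
rewrite /dotv !mulr_sumr -!big_split /=; apply: eq_bigr => i _.
by rewrite !mxE; ring.
Qed.

Lemma dotv_cauchy u v : dotv u v ^+ 2 <= dotv u u * dotv v v.
Proof.
have := dotv_ge0 v; rewrite le_eqVlt => /predU1P[/esym v0|v0].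
  rewrite v0 mulr0 (_ : dotv u v = 0) ?expr0n//.
  rewrite /dotv big1// => i _.
  have : v 0 i * v 0 i == 0.
    move/eqP: v0; rewrite /dotv psumr_eq0.
      by move=> /allP/(_ i); apply; rewrite mem_index_enum.
    by move=> j _; rewrite -expr2 sqr_ge0.
  by rewrite mulf_eq0 orbb => /eqP ->; rewrite mulr0.
have := dotv_ge0 (dotv v v *: u + (- dotv u v) *: v).
rewrite dotv_comb => h.
have : 0 <= dotv v v * (dotv u u * dotv v v - dotv u v ^+ 2).
  by apply: (le_trans h); rewrite le_eqVlt; apply/orP; left; apply/eqP; ring.
by rewrite pmulr_rge0// subr_ge0.
Qed.

Lemma enorm_triangle u v : enorm (u + v) <= enorm u + enorm v.
Proof.
rewrite -(@ler_pXn2r _ 2) ?nnegrE ?addr_ge0 ?enorm_ge0//.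
rewrite sqrrD !sqr_sqrtr ?dotv_ge0//.
have := dotv_comb 1 1 u v; rewrite !scale1r => ->.
rewrite !expr1n !mul1r lerD2r lerD2l mulr_natl lerMn2r/=.
apply: (le_trans (ler_norm _)).
rewrite -sqrtr_sqr -sqrtrM ?dotv_ge0// ler_wsqrtr//.
exact: dotv_cauchy.
Qed.

Lemma mx_norm_le_enorm u : `|u| <= enorm u.
Proof.
rewrite [leLHS]/Num.norm/= mx_normrE.
apply/bigmax_leP; split=> [|[i j] _]; first exact: enorm_ge0.
rewrite /= -sqrtr_sqr ler_wsqrtr// ord1 /dotv (bigD1 j)//= -expr2.
by rewrite lerDl sumr_ge0// => k _; rewrite -expr2 sqr_ge0.
Qed.

Lemma mx_coord_le_norm u i : `|u 0 i| <= `|u|.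
Proof.
rewrite [leRHS]/Num.norm/= mx_normrE.
exact: (le_bigmax _ (fun ij : 'I_1 * 'I_d => `|u ij.1 ij.2|) (0, i)).
Qed.

Lemma enorm_le_mx_norm u : enorm u <= Num.sqrt d%:R * `|u|.
Proof.
rewrite -(@ler_pXn2r _ 2) ?nnegrE ?mulr_ge0 ?enorm_ge0 ?sqrtr_ge0//.
rewrite exprMn !sqr_sqrtr ?dotv_ge0// /dotv.
apply: (@le_trans _ _ (\sum_(i < d) `|u| ^+ 2)); last first.
  by rewrite sumr_const card_ord mulr_natl.
apply: ler_sum => i _; rewrite -expr2 -real_normK ?num_real//.
by rewrite lerXn2r ?nnegrE// mx_coord_le_norm.
Qed.

End enorm_lemmas.

Section hausdorff_dist_lemmas.
Context {R : realType} {d : nat}.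
Implicit Types (A B C : set 'rV[R]_d) (x y : 'rV[R]_d).
Local Open Scope ereal_scope.

Lemma hausdorff_distC A B : hausdorff_dist A B = hausdorff_dist B A.
Proof. by rewrite /hausdorff_dist maxC. Qed.

Lemma hausdorff_dist_leP A B (r : R) : hausdorff_dist A B <= r%:E <->
  (forall e : R, (r < e)%R ->
    (forall x, A x -> exists2 y, B y & (enorm (x - y) < e)%R) /\
    (forall x, B x -> exists2 y, A y & (enorm (x - y) < e)%R)).
Proof.
have half (S T : set 'rV[R]_d) :
    ereal_sup [set ereal_inf [set (enorm (x - y))%:E | y in T] | x in S]
      <= r%:E <->
    forall e : R, (r < e)%R ->
      forall x, S x -> exists2 y, T y & (enorm (x - y) < e)%R.
  split=> [h e re x Sx|h].
    have : ereal_inf [set (enorm (x - y))%:E | y in T] < e%:E.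
      apply: le_lt_trans (_ : r%:E < e%:E); last by rewrite lte_fin.
      by apply: le_trans h; apply: ereal_sup_ubound; exists x.
    by move=> /ereal_inf_lt[_ [y Ty <-]]; rewrite lte_fin => ?; exists y.
  apply: ge_ereal_sup => _ [x Sx <-]; apply/lee_addgt0Pr => e e0.
  have [|y Ty xy] := h (r + e)%R _ x Sx; first by rewrite ltrDl.
  apply: (@le_trans _ _ (enorm (x - y))%:E).
    by apply: ereal_inf_lbound; exists y.
  by rewrite -EFinD lee_fin ltW.
rewrite /hausdorff_dist ge_max; split=> [/andP[/half h1 /half h2] e re|h].
  by split; [exact: h1|exact: h2].
by apply/andP; split; apply/half => e re; have [] := h e re.
Qed.

Lemma convex_body0_bounded A : convex_body0 A ->
  exists2 M : R, (0 <= M)%R & forall x, A x -> (enorm x <= M)%R.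
Proof.
move=> [/compact_bounded[M [Mr hM]] _ _].
exists (Num.sqrt d%:R * (`|M| + 1))%R; first by rewrite mulr_ge0// addr_ge0.
move=> x Ax; apply: (le_trans (enorm_le_mx_norm _)).
rewrite ler_wpM2l// hM// (le_lt_trans (ler_norm M))// ltrDl//.
Qed.

Lemma hausdorff_dist_ge0 A B : convex_body0 A -> 0 <= hausdorff_dist A B.
Proof.
move=> [_ _ A0]; rewrite /hausdorff_dist le_max; apply/orP; left.
apply: (@le_trans _ _ (ereal_inf [set (enorm (0 - y))%:E | y in B])).
  by apply: le_ereal_inf_tmp => _ [y _ <-]; rewrite lee_fin enorm_ge0.
by apply: ereal_sup_ubound; exists 0%R.
Qed.

Lemma hausdorff_dist_fin A B : convex_body0 A -> convex_body0 B ->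
  hausdorff_dist A B \is a fin_num.
Proof.
move=> bA bB; rewrite ge0_fin_numE; last exact: hausdorff_dist_ge0.
have [M M0 hM] := convex_body0_bounded bA.
have [N N0 hN] := convex_body0_bounded bB.
apply: (@le_lt_trans _ _ (M + N)%:E); last exact: ltry.
apply/hausdorff_dist_leP => e he; case: bA bB => _ _ A0 [_ _ B0].
split=> x hx; exists 0%R => //; rewrite subr0; apply: le_lt_trans he.
  by rewrite (le_trans (hM x hx))// lerDl.
by rewrite (le_trans (hN x hx))// lerDr.
Qed.

Lemma hausdorff_dist_eq0 A B : closed A -> closed B ->
  hausdorff_dist A B = 0 -> A = B.
Proof.
move=> cA cB h.
have {}h : hausdorff_dist A B <= 0%:E by rewrite h.
have [h1 h2] : A `<=` B /\ B `<=` A; last by apply/seteqP.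
have key (S T : set 'rV[R]_d) : closed T ->
    (forall e : R, (0 < e)%R ->
      forall x, S x -> exists2 y, T y & (enorm (x - y) < e)%R) -> S `<=` T.
  move=> cT hST x Sx; apply: cT => U /nbhs_ballP[e /= e0 eU].
  have [y Ty xy] := hST e e0 x Sx; exists y; split => //; apply: eU.
  by rewrite -ball_normE /=; apply: le_lt_trans xy; exact: mx_norm_le_enorm.
split; apply: key => // e e0.
  exact: ((hausdorff_dist_leP _ _ _).1 h e e0).1.
exact: ((hausdorff_dist_leP _ _ _).1 h e e0).2.
Qed.

Lemma hausdorff_dist_triangle A B C (r s : R) :
  hausdorff_dist A B <= r%:E -> hausdorff_dist B C <= s%:E ->
  hausdorff_dist A C <= (r + s)%:E.
Proof.
move=> /hausdorff_dist_leP hAB /hausdorff_dist_leP hBC.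
apply/hausdorff_dist_leP => e he.
pose t := ((e - (r + s)) / 2)%R.
have t0 : (0 < t)%R by rewrite divr_gt0// subr_gt0.
have et : e = ((r + t) + (s + t))%R by rewrite /t; field.
have [AB BA] := hAB (r + t)%R ltac:(by rewrite ltrDl).
have [BC CB] := hBC (s + t)%R ltac:(by rewrite ltrDl).
split=> x hx.
  have [y /BC[z Cz yz] xy] := AB x hx; exists z => //.
  rewrite et (_ : x - z = (x - y) + (y - z))%R; last by rewrite addrA subrK.
  by rewrite (le_lt_trans (enorm_triangle _ _))// ltrD.
have [y /BA[z Cz yz] xy] := CB x hx; exists z => //.
rewrite et [(r + t + _)%R]addrC (_ : x - z = (x - y) + (y - z))%R; last first.
  by rewrite addrA subrK.
by rewrite (le_lt_trans (enorm_triangle _ _))// ltrD.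
Qed.

End hausdorff_dist_lemmas.

Section body_metric.
Context {R : realType} {d : nat}.
Implicit Types K L M : body R d.

Definition body_dist K L : R := fine (hausdorff_dist K L).

Lemma body_distE K L : hausdorff_dist K L = (body_dist K L)%:E.
Proof. by rewrite fineK// hausdorff_dist_fin//; exact: body_convex_body0. Qed.

Lemma body_closed K : closed K.
Proof.
by apply: compact_closed; [exact: norm_hausdorff|have [] := body_convex_body0 K].
Qed.

Lemma body_ext K L : K = L :> set _ -> K = L.
Proof.
case: K L => [A hA A0] [B hB B0] /= AB; subst B.
by congr Body; exact: Prop_irrelevance.
Qed.

Let distxx K : body_dist K K = 0.
Proof.
apply/eqP; rewrite eq_le; apply/andP; split; last first.
  by apply: fine_ge0; apply: hausdorff_dist_ge0; exact: body_convex_body0.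
rewrite -lee_fin -body_distE; apply/hausdorff_dist_leP => e e0.
by split=> x Kx; exists x; rewrite ?subrr ?enorm0.
Qed.

Let dist_positivity K L : body_dist K L = 0 -> K = L.
Proof.
move=> KL; apply/body_ext/hausdorff_dist_eq0; rewrite ?body_distE ?KL//;
  exact: body_closed.
Qed.

Let dist_sym K L : body_dist K L = body_dist L K.
Proof. by rewrite /body_dist hausdorff_distC. Qed.

Let dist_triangle L K M : body_dist K M <= body_dist K L + body_dist L M.
Proof.
rewrite -lee_fin -body_distE; apply: (@hausdorff_dist_triangle _ _ _ L).
  by rewrite body_distE.
by rewrite body_distE.
Qed.

HB.instance Definition _ := @isMetric.Build R (body R d)
  body_dist distxx dist_positivity dist_sym dist_triangle.

End body_metric.

(* There is no [body] in dimension 0, whereas measurable types must be inhabited;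
   hence the successor dimension from here on. *)
Section body_borel.
Context {R : realType} {d : nat}.

Let cube : set 'rV[R]_d.+1 := [set v | `|v| <= 1].

Let cube_convex_body0 : convex_body0 cube.
Proof.
split.
- have -> : cube = closed_ball 0 1.
    by rewrite closed_ballE//; apply/seteqP; split => x /=;
      rewrite /closed_ball_ /= sub0r normrN.
  apply: bounded_closed_compact; last exact: closed_ball_closed.
  exists 1; split => [|M M1 x]; first exact: num_real.
  rewrite closed_ballE// /closed_ball_ /= sub0r normrN => x1.
  by rewrite (le_trans x1)// ltW.
- move=> x y t; rewrite !inE /cube /= => x1 y1.
  have t0 : 0 <= t%:num by [].
  have t1 : 0 <= 1 - t%:num by rewrite subr_ge0.
  apply: (le_trans (ler_normD _ _)); rewrite !normrZ !ger0_norm//.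
  apply: (@le_trans _ _ (t%:num * 1 + (1 - t%:num) * 1)).
    by rewrite lerD// ler_wpM2l.
  by rewrite !mulr1 addrCA subrr addr0.
- by rewrite /cube /= normr0.
Qed.

Let cube_neq0 : cube <> [set 0].
Proof.
move=> /seteqP[+ _] => /(_ (const_mx 1)) /=.
have h : cube (const_mx 1).
  rewrite /cube /= [leLHS]/Num.norm/= mx_normrE.
  by apply/bigmax_leP; split => // i _; rewrite mxE normr1.
move=> /(_ h) /matrixP/(_ 0 0); rewrite !mxE => /eqP.
by rewrite oner_eq0.
Qed.

HB.instance Definition _ := isPointed.Build (body R d.+1)
  (Body cube_convex_body0 cube_neq0).

HB.instance Definition _ := Measurable.copy (body R d.+1)
  (g_sigma_algebraType (@open (body R d.+1))).

End body_borel.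

Section sum_dirac.
Context {R : realType} {d : nat} {I : choiceType} (A : I -> body R d.+1).
Local Open Scope ereal_scope.

Definition sum_dirac (U : set (body R d.+1)) : \bar R :=
  \esum_(i in [set: I]) \d_(A i) U.

Let sum_dirac0 : sum_dirac set0 = 0.
Proof. by rewrite /sum_dirac esum1// => i _; rewrite measure0. Qed.

Let sum_dirac_ge0 U : 0 <= sum_dirac U.
Proof. by apply: esum_ge0 => i _. Qed.

Let sum_dirac_sigma_additive : semi_sigma_additive sum_dirac.
Proof.
move=> F mF tF mUF.
have -> : sum_dirac (\bigcup_n F n) = \sum_(n <oo) sum_dirac (F n).
  rewrite nneseries_esumT//.
  transitivity (\esum_(i in [set: I]) \esum_(n in [set: nat]) (\d_(A i) (F n) : \bar R)).
    apply: eq_esum => i _; rewrite -nneseries_esumT//.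
    by rewrite measure_semi_bigcup.
  rewrite esum_esum// /sum_dirac esum_esum//.
  rewrite (reindex_esum (setT `*`` (fun=> setT)) _ (fun x => (x.2, x.1)))//.
  split=> //=.
  - by move=> [i n] [j m] _ _ [-> ->].
  - by move=> [i n] _; exists (n, i).
apply: is_cvg_nneseries => n _ _; exact: sum_dirac_ge0.
Qed.

HB.instance Definition _ := isMeasure.Build _ _ _
  sum_dirac sum_dirac0 sum_dirac_ge0 sum_dirac_sigma_additive.

End sum_dirac.

Section vague_convergence.
Context {R : realType} {d : nat}.
Implicit Types mu nu : {measure set (body R d.+1) -> \bar R}.

Definition body_radius (K : body R d.+1) : \bar R :=
  ereal_sup [set (enorm x)%:E | x in (K : set 'rV[R]_d.+1)].

Definition locally_finite mu : Prop := forall r : R, 0 < r ->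
  (mu [set K : body R d.+1 | r%:E <= body_radius K] < +oo)%E.

Definition vague_cvg (mu_ : nat -> {measure set (body R d.+1) -> \bar R}) mu
    : Prop :=
  forall f : body R d.+1 -> R, continuous f -> bounded_fun f ->
    (exists2 r : R, 0 < r &
      forall K : body R d.+1, (hausdorff_dist K [set 0%R] < r%:E)%E -> f K = 0) ->
  (\int[mu_ n]_K (f K)%:E)%E @[n --> \oo] --> (\int[mu]_K (f K)%:E)%E.

Definition atom mu (K : body R d.+1) : Prop := (0 < mu [set K])%E.

End vague_convergence.

(* Main.v *)
(* Since 0 is interior to the hull of A after deleting any finite set, one finds
   m + 1 disjoint finite subfamilies with 0 interior to each hull.  Deleting m
   sets spares one of them, so a fixed ball rB lies in all hulls conv(A \ J),
   |J| = m, and only the finitely many sets of norm >= rho, for some rho <= r/2,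
   matter for the peeling.  Vague convergence matches these one to one with the
   sets of norm >= rho of A^(n), up to a small Hausdorff distance e (the matched
   sets may drop slightly below rho).  Deletions on either side are transported
   through the matching, and if C contains sB then C + eB is contained in
   (1 + e/s) C; hence each of the two peelings, scaled by s / (s + e) with
   s = r/2, is contained in the other. *)
Require Import Defs.
From mathcomp Require Import all_boot all_order all_algebra.
From mathcomp Require Import all_classical all_reals all_analysis.
From mathcomp Require Import finmap measurable_realfun ring lra.

Import Order.TTheory GRing.Theory Num.Theory.
Import numFieldNormedType.Exports.

Local Open Scope classical_set_scope.
Local Open Scope card_scope.
Local Open Scope ring_scope.

Set Implicit Arguments.
Unset Strict Implicit.
Unset Printing Implicit Defensive.

(** * Convex hulls and balls *)

Section euclidean_geometry.
Context {R : realType} {d : nat}.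
Implicit Types (x y c : 'rV[R]_d) (S C : set 'rV[R]_d) (r e a : R).

Definition eball r : set 'rV[R]_d := [set x | enorm x <= r].

Lemma enormZ a x : enorm (a *: x) = `|a| * enorm x.
Proof.
rewrite /enorm /dotv -sqrtr_sqr -sqrtrM ?sqr_ge0// mulr_sumr.
by congr Num.sqrt; apply: eq_bigr => i _; rewrite !mxE; ring.
Qed.

Lemma convex_setP C : @convex_set R 'rV[R]_d C <->
  forall x y a, C x -> C y -> 0 <= a <= 1 -> C (a *: x + (1 - a) *: y).
Proof.
split=> [cC x y a Cx Cy a01|cC x y a /set_mem Cx /set_mem Cy]; last first.
  by apply/mem_set/cC => //; apply/andP; split.
have /andP[a0 a1] := a01.
exact: set_mem (cC x y (Itv01 a0 a1) (mem_set Cx) (mem_set Cy)).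
Qed.

(** The sup norm is at most the Euclidean norm, which is at most [Num.sqrt d%:R] times the sup norm,
    so closedness can be tested with Euclidean distances. *)
Lemma closed_enormP C : closed C <->
  forall x, (forall e, 0 < e -> exists2 y, C y & enorm (x - y) < e) -> C x.
Proof.
split=> cC x h.
  apply: cC => U /nbhs_ballP[e /= e0 eU]; have [y Cy xy] := h e e0.
  exists y; split => //; apply: eU; rewrite -ball_normE /=.
  exact: le_lt_trans (mx_norm_le_enorm _) xy.
apply: cC => e e0.
(* The summand 1 keeps the constant positive even when [d] is 0. *)
pose k := Num.sqrt d%:R + 1 : R.
have k0 : 0 < k by rewrite ltr_wpDl ?sqrtr_ge0.
have [y [Cy]] := h (ball x (e / k)) (nbhsx_ballx _ _ (divr_gt0 e0 k0)).
rewrite -ball_normE /= ltr_pdivlMr// => xy; exists y => //.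
apply: le_lt_trans (enorm_le_mx_norm _) _; apply: le_lt_trans xy.
by rewrite mulrC ler_wpM2l// lerDl.
Qed.

Lemma closed_conv_hullP S :
  closed (closed_conv_hull S) /\ @convex_set R 'rV[R]_d (closed_conv_hull S).
Proof.
split; first by apply: closed_bigI => C [[]].
apply/convex_setP => x y a hx hy a01 C [/[dup][[cC kC]] CC SC].
have /convex_setP := kC; apply => //; [exact: hx|exact: hy].
Qed.

Lemma closed_conv_hull_min S C : closed C -> @convex_set R 'rV[R]_d C ->
  S `<=` C -> closed_conv_hull S `<=` C.
Proof. by move=> cC kC SC x; apply. Qed.

Lemma sub_closed_conv_hull S : S `<=` closed_conv_hull S.
Proof. exact: sub_gen_smallest. Qed.

Lemma closed_conv_hullS S C : S `<=` C ->
  closed_conv_hull S `<=` closed_conv_hull C.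
Proof.
move=> SC; have [cl cv] := closed_conv_hullP C.
by apply: closed_conv_hull_min => //; apply: subset_trans (@sub_closed_conv_hull C).
Qed.

Lemma conv_hull_sub_closed S : conv_hull S `<=` closed_conv_hull S.
Proof.
by apply: smallest_sub; [case: (closed_conv_hullP S)|exact: sub_closed_conv_hull].
Qed.

Lemma enorm_comb a x y : 0 <= a <= 1 ->
  enorm (a *: x + (1 - a) *: y) <= a * enorm x + (1 - a) * enorm y.
Proof.
move=> /andP[a0 a1]; apply: le_trans (enorm_triangle _ _) _.
by rewrite !enormZ !ger0_norm ?subr_ge0.
Qed.

(** The points at distance at most [e] from a convex set form a closed convex set, which therefore
    contains the hull. A strict bound for every [e' > e] stands for this distance, since it need not
    be attained when [C] is not closed. *)
Lemma closed_conv_hull_near S C e : @convex_set R 'rV[R]_d C ->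
  (forall x, S x -> exists2 c, C c & enorm (x - c) <= e) ->
  forall x, closed_conv_hull S x ->
  forall e', e < e' -> exists2 c, C c & enorm (x - c) < e'.
Proof.
move=> /convex_setP kC SC.
apply: (@closed_conv_hull_min S
    [set x | forall e', e < e' -> exists2 c, C c & enorm (x - c) < e']).
- apply/closed_enormP => x xS e' ee'.
  have ee2 : e < (e + e') / 2 by lra.
  have [|y yS xy] := xS ((e' - e) / 2); first by lra.
  have [c Cc yc] := yS _ ee2; exists c => //.
  rewrite (_ : x - c = (x - y) + (y - c)); last by rewrite addrA subrK.
  by apply: le_lt_trans (enorm_triangle _ _) _; lra.
- apply/convex_setP => x y a xS yS a01 e' ee'.
  have ee2 : e < (e + e') / 2 by lra.
  have [c Cc xc] := xS _ ee2; have [c' Cc' yc] := yS _ ee2.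
  exists (a *: c + (1 - a) *: c'); first exact: kC.
  rewrite opprD addrACA -!scalerBr; apply: le_lt_trans (enorm_comb _ _ a01) _.
  by nra.
- by move=> x /SC[c Cc xc] e' ee'; exists c => //; exact: le_lt_trans xc ee'.
Qed.

Lemma closed_conv_hull_bounded S r :
  S `<=` eball r -> closed_conv_hull S `<=` eball r.
Proof.
move=> Sr x xS; apply/ler_addgt0Pr => e e0.
have kC : @convex_set R 'rV[R]_d [set 0].
  by apply/convex_setP => ? ? a -> -> _; rewrite !scaler0 addr0.
have near0 y : S y -> exists2 c, [set 0] c & enorm (y - c) <= r.
  by move=> /Sr yr; exists 0 => //; rewrite subr0.
have [|_ -> ] := closed_conv_hull_near kC near0 xS (e' := r + e).
  by rewrite ltrDl.
by rewrite subr0 => /ltW.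
Qed.

(* If [x = c0 + b/2] with [c0] in [C] and [b] in the ball, expanding [b] in the
   same way again and again writes [x/2] as a limit of
   [c0/2 + c1/4 + c2/8 + ...], an average of points of [C]. *)
Lemma eball_sub_of_near C r : 0 < r -> closed C ->
  @convex_set R 'rV[R]_d C -> C 0 ->
  (forall x, eball r x -> exists2 c, C c & enorm (x - c) <= r / 2) ->
  eball (r / 2) `<=` C.
Proof.
move=> r0 /closed_enormP clC /convex_setP kC C0 near.
have approx N x : eball r x ->
    exists2 c, C c & enorm (2^-1 *: x - c) <= 2^-1 ^+ N * r.
  elim: N x => [|N IH] x xr.
    exists 0 => //; rewrite subr0 expr0 mul1r enormZ ger0_norm//.
    by rewrite /eball/= in xr; have := enorm_ge0 x; lra.
  have [c Cc xc] := near x xr.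
  have [|c' Cc' hc'] := IH (2 *: (x - c)).
    by rewrite /eball/= enormZ ger0_norm//; lra.
  exists (2^-1 *: c + (1 - 2^-1) *: c'); first by apply: kC => //; lra.
  have -> : 2^-1 *: x - (2^-1 *: c + (1 - 2^-1) *: c') =
      2^-1 *: (2^-1 *: (2 *: (x - c)) - c').
    by apply/rowP => i; rewrite !mxE; field.
  by rewrite enormZ ger0_norm// exprS -mulrA ler_pM2l// invr_gt0.
move=> x xr; apply: clC => e e0.
have [N hN] : exists N : nat, 2^-1 ^+ N * r < e.
  have : (fun n => (2^-1 : R) ^+ n) @ \oo --> 0.
    by apply: cvg_expr; rewrite ger0_norm//; lra.
  move=> /cvgrPdist_lt/(_ _ (divr_gt0 e0 r0))[N _ /(_ N (leqnn N))] /=.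
  rewrite sub0r normrN ger0_norm ?exprn_ge0// ltr_pdivlMr// => h.
  by exists N.
have [|c Cc hc] := approx N (2 *: x).
  by move: xr; rewrite /eball/= enormZ ger0_norm//; lra.
exists c => //; apply: le_lt_trans hN; move: hc.
by rewrite scalerA mulVf ?scale1r.
Qed.

(** The scaled point is a convex combination of [y], with weight [s / (s + e)], and of
    [(s / e) *: (x - y)], which lies in [eball s]. *)
Lemma scale_near_mem C s e x y : 0 < s -> 0 < e -> @convex_set R 'rV[R]_d C ->
  eball s `<=` C -> C y -> enorm (x - y) <= e -> C ((s / (s + e)) *: x).
Proof.
move=> s0 e0 /convex_setP kC sC Cy xy.
have se0 : 0 < s + e by rewrite addr_gt0.
have -> : (s / (s + e)) *: x = (s / (s + e)) *: y +
    (1 - s / (s + e)) *: ((s / e) *: (x - y)).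
  by apply/rowP => i; rewrite !mxE; field; rewrite !gt_eqF.
apply: kC => //.
  have se : 0 <= s / e by rewrite divr_ge0 ?ltW.
  apply: sC; rewrite /eball/= enormZ ger0_norm//.
  by rewrite mulrAC ler_pdivrMr// ler_pM2l.
by rewrite divr_ge0 ?(ltW s0) ?(ltW se0)//= ler_pdivrMr// mul1r lerDl ltW.
Qed.

End euclidean_geometry.

(** * The norm of a convex body *)

Section body_norm.
Context {R : realType} {d : nat}.
Implicit Types (K L : body R d) (r : R).

(** This is the largest Euclidean norm of a point of [K]. It is written as a distance to {0} because
    test functions for vague convergence vanish near {0} in that distance. *)
Definition body_norm K : R := fine (hausdorff_dist K [set 0]).

Lemma body_normE K : hausdorff_dist K [set 0] = (body_norm K)%:E.
Proof.
rewrite fineK// hausdorff_dist_fin//; first exact: body_convex_body0.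
split => //; first exact: compact_set1.
by apply/convex_setP => ? ? a -> -> _; rewrite !scaler0 addr0.
Qed.

Lemma body0 K : (K : set _) 0.
Proof. by have [] := body_convex_body0 K. Qed.

Lemma body_sub_eball K : (K : set _) `<=` eball (body_norm K).
Proof.
have /hausdorff_dist_leP h : (hausdorff_dist K [set 0%R] <= (body_norm K)%:E)%E.
  by rewrite body_normE.
move=> x Kx; apply/ler_addgt0Pr => e e0.
have [/(_ x Kx)[_ -> ] ] := h (body_norm K + e) ltac:(by rewrite ltrDl).
by rewrite subr0 => /ltW.
Qed.

Lemma body_norm_le K r : (K : set _) `<=` eball r -> body_norm K <= r.
Proof.
move=> Kr; rewrite -lee_fin -body_normE; apply/hausdorff_dist_leP => e re.
split=> [x /Kr xr|_ ->].
  by exists 0 => //; rewrite subr0; exact: le_lt_trans xr re.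
exists 0; first exact: body0.
rewrite subr0; apply: le_lt_trans re.
exact: Kr (body0 K).
Qed.

Lemma body_norm_gt0 K : 0 < body_norm K.
Proof.
rewrite ltNge; apply/negP => K0; apply: (body_neq0 (b := K)).
apply/seteqP; split=> [x Kx|_ ->]; last exact: body0.
apply/eqP; rewrite -normr_le0; apply: le_trans (mx_norm_le_enorm _) _.
exact: le_trans (body_sub_eball Kx) K0.
Qed.

Lemma body_norm_lip K L : `|body_norm K - body_norm L| <= body_dist K L.
Proof.
have half K' L' : body_norm K' <= body_dist K' L' + body_norm L'.
  rewrite -lee_fin -body_normE; apply: (@hausdorff_dist_triangle _ _ _ L').
    by rewrite body_distE.
  by rewrite body_normE.
have LK : body_dist L K = body_dist K L by rewrite /body_dist hausdorff_distC.
by rewrite ler_norml; have := half K L; have := half L K; rewrite LK; lra.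
Qed.

Lemma body_dist_near K L e : body_dist K L < e ->
  forall x, (K : set _) x -> exists2 y, (L : set _) y & enorm (x - y) <= e.
Proof.
have /hausdorff_dist_leP h : (hausdorff_dist K L <= (body_dist K L)%:E)%E.
  by rewrite body_distE.
by move=> /h[KL _] x /KL[y Ly /ltW]; exists y.
Qed.

End body_norm.

(** * Bounds over finite sets, and cardinalities *)

Section finite_sets.
Context {T : choiceType}.

Lemma finite_lower_bound {R : realFieldType} (f : T -> R) (F : set T) :
  finite_set F -> (forall i, F i -> 0 < f i) ->
  exists2 e, 0 < e & forall i, F i -> e <= f i.
Proof.
move=> /finite_seqP[s ->]; elim: s => [|i s IH] fs; first by exists 1.
have [|e e0 he] := IH; first by move=> j js; apply: fs; rewrite /= inE js orbT.
exists (Num.min (f i) e); first by rewrite lt_min e0 fs//= mem_head.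
move=> j /=; rewrite inE => /predU1P[->|/he h]; first by rewrite ge_min lexx.
by rewrite ge_min h orbT.
Qed.

Lemma card_le_fset (X : {fset T}) m : ([set` X] #<= `I_m) = (#|` X| <= m)%N.
Proof.
have h : [set` X] #= `I_#|` X| by apply/card_eq_fsetP.
by rewrite (card_le_eql h) card_le_II.
Qed.

Lemma card_le_fsetP (X : set T) m : X #<= `I_m ->
  exists2 Y : {fset T}, X = [set` Y] & (#|` Y| <= m)%N.
Proof.
move=> Xm; have Xfin : finite_set X by apply/finite_set_leP; exists m.
by exists (fset_set X); [rewrite fset_setK|exact: geq_card_fset_set].
Qed.

(** A peeling deletes exactly [m] sets, whereas a deletion carried over to another family may have
    fewer; this fills it up, one element at a time. *)
Lemma card_extend (X : set T) m : X #<= `I_m -> `I_m #<= [set: T] ->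
  exists2 J, X `<=` J & J #= `I_m.
Proof.
elim: m X => [|m IH] X.
  by rewrite II0 card_le0 => /eqP -> _; exists set0.
move=> /card_le_fsetP[Y ->]; rewrite leq_eqVlt => /predU1P[Ym _|Ym mT].
  by exists [set` Y] => //; apply/card_eq_fsetP.
have [||J YJ Jm] := IH [set` Y]; first by rewrite card_le_fset -ltnS.
  by apply: card_le_trans mT; rewrite card_le_II.
have [Z JZ Zm] : exists2 Z : {fset T}, J = [set` Z] & #|` Z| = m.
  exists (fset_set J); last exact: card_fset_set.
  by rewrite fset_setK//; apply/finite_setP; exists m.
have [x xZ] : exists x, x \notin Z.
  apply: contrapT => /forallNP ZT; have : `I_m.+1 #<= `I_m; last by rewrite card_le_II ltnn.
  apply: card_le_trans mT _; rewrite -(card_le_eqr Jm).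
  by apply: subset_card_le => x _; rewrite JZ/=; have /negP := ZT x; rewrite negbK.
exists [set` (x |` Z)%fset].
  by apply: subset_trans YJ _; rewrite JZ => y /=; rewrite !inE => ->; rewrite orbT.
by apply/card_eq_fsetP; rewrite cardfsU1 xZ Zm.
Qed.

End finite_sets.

(** * Hulls and peelings of families *)

Section families.
Context {R : realType} {d : nat}.

Definition fam_closed_conv (I : choiceType) (A : I -> body R d) (D : set I) :=
  closed_conv_hull (\bigcup_(i in D) (A i : set 'rV[R]_d)).

Lemma fam_closed_convP (I : choiceType) (A : I -> body R d) (D : set I) :
  closed (fam_closed_conv A D) /\ @convex_set R 'rV[R]_d (fam_closed_conv A D).
Proof. exact: closed_conv_hullP. Qed.

Lemma fam_closed_convS (I : choiceType) (A : I -> body R d) (D E : set I) :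
  D `<=` E -> fam_closed_conv A D `<=` fam_closed_conv A E.
Proof. by move=> DE; apply: closed_conv_hullS; exact: bigcup_subset. Qed.

Lemma sub_fam_closed_conv (I : choiceType) (A : I -> body R d) (D : set I) i x :
  D i -> (A i : set _) x -> fam_closed_conv A D x.
Proof. by move=> Di Aix; apply: sub_closed_conv_hull; exists i. Qed.

Lemma fam_closed_conv_nonempty (I : choiceType) (A : I -> body R d) (D : set I) x :
  fam_closed_conv A D x -> D !=set0.
Proof.
move=> Ax; apply: contrapT => /set0P/negP/negPn/eqP D0.
move: Ax; rewrite /fam_closed_conv D0 bigcup_set0 => /(_ set0); apply.
by split => //; split; [exact: closed0|by move=> ? ? ? /set_mem].
Qed.

(** Replacing by 0 the bodies of norm below [e / 8] moves points of the hull by at most [e / 8]. So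
    the hull of the finitely many others comes within [e / 4] of every point of [eball (e / 2)], and
    [eball_sub_of_near] applies. *)
Lemma eball_fam_closed_conv (I : choiceType) (A : I -> body R d) (D : set I) :
  (forall e, 0 < e -> finite_set [set i | e <= body_norm (A i)]) ->
  (fam_conv D A)° 0 ->
  exists2 r, 0 < r & exists2 G, finite_set G &
    G `<=` D /\ eball r `<=` fam_closed_conv A G.
Proof.
move=> A_lf; rewrite /interior => /nbhs_ballP[e /= e0 eD].
have [i0 Di0] : D !=set0.
  apply: contrapT => /set0P/negP/negPn/eqP D0; have := eD 0 (ballxx _ e0).
  rewrite /fam_conv D0 bigcup_set0 => /(_ set0); apply; split => //.
(* The index [i0] makes [G] nonempty, so that its hull contains 0. *)
pose G := [set i | D i /\ e / 8 <= body_norm (A i)] `|` [set i0].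
exists (e / 4); first by lra.
exists G.
  rewrite finite_setU; split; last exact: finite_set1.
  apply: sub_finite_set (A_lf (e / 8) _); last by lra.
  by move=> i [].
split; first by move=> i [[]|->].
rewrite (_ : e / 4 = (e / 2) / 2); last by field.
have [clG cvG] := fam_closed_convP A G.
have G0 : fam_closed_conv A G 0.
  by apply: (@sub_fam_closed_conv _ _ _ i0); [right|exact: body0].
apply: eball_sub_of_near => //; first by lra.
move=> x xe.
have xD : closed_conv_hull (\bigcup_(i in D) (A i : set _)) x.
  apply: conv_hull_sub_closed; apply: eD.
  suff : ball (0 : 'rV[R]_d) e x by [].
  rewrite -ball_normE/= sub0r normrN.
  by apply: le_lt_trans (mx_norm_le_enorm _) _; apply: le_lt_trans xe _; lra.
have [||c Gc xc] := closed_conv_hull_near (e := e / 8) cvG _ xD (e' := e / 4).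
- move=> y [i Di Aiy]; have [big|small] := leP (e / 8) (body_norm (A i)).
    exists y; last by rewrite subrr enorm0; lra.
    by apply: sub_fam_closed_conv Aiy; left.
  exists 0 => //; rewrite subr0.
  by apply: le_trans (body_sub_eball Aiy) _; exact: ltW.
- lra.
by exists c => //; lra.
Qed.

(* Choosing [m + 1] disjoint finite families, each with 0 interior to its hull,
   one of them survives the deletion of any [m] sets. *)
Lemma eball_fam_closed_convD (I : choiceType) (A : I -> body R d) m :
  (forall e, 0 < e -> finite_set [set i | e <= body_norm (A i)]) ->
  (forall F, finite_set F -> (fam_conv (~` F) A)° 0) ->
  exists2 r, 0 < r & exists2 G, finite_set G &
    forall J, J #<= `I_m -> eball r `<=` fam_closed_conv A (G `\` J).
Proof.
move=> A_lf A_int; elim: m => [|m [r r0 [G finG IH]]].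
  have [r r0 [G finG [_ rG]]] := eball_fam_closed_conv A_lf (A_int _ (finite_set0 _)).
  by exists r => //; exists G => // J; rewrite II0 card_le0 => /eqP ->; rewrite setD0.
have [s s0 [H finH [HG sH]]] := eball_fam_closed_conv A_lf (A_int _ finG).
exists (Num.min r s); first by rewrite lt_min r0.
exists (G `|` H); first by rewrite finite_setU.
move=> J /card_le_fsetP[Y -> Ym] x; rewrite /eball/= le_min => /andP[xr xs].
have [YH|/set0P/negP/negPn/eqP YH] := pselect (H `&` [set` Y] !=set0); last first.
  apply: (@fam_closed_convS _ _ H); last exact: sH.
  by move=> i Hi; split; [right|move=> Yi; rewrite -[False]/(set0 i) -YH].
have [i [Hi /= Yi]] := YH.
(* The deletion spends [i] on [H], which is disjoint from [G]; at most [m] of its elements can hit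
   [G], and the induction hypothesis applies. *)
apply: (@fam_closed_convS _ _ (G `\` [set` Y `\ i]%fset)).
  move=> j [Gj /= Yj]; split; [by left|move=> /= jY; apply: Yj].
  by rewrite !inE jY andbT; apply: contraPneq Gj => ->; exact: HG.
apply: IH => //; rewrite card_le_fset.
by move: Ym; rewrite (cardfsD1 i) Yi.
Qed.

(** A deletion [J] from [A'] is carried by [g] to one from [A] and enlarged to some [J'] of size
    [m]. A body of [A] outside [J'] either lies in [eball s], or is within [e] of a body of [A']
    outside [J]. In both cases the scaling takes it into the hull of [A'] without [J], and the
    preimage of this hull under the scaling is closed and convex. *)
Lemma peeling_scale (I I' : choiceType) (A : I -> body R d) (A' : I' -> body R d)
    (g : I' -> I) m s e :
  0 < s -> 0 < e -> `I_m #<= [set: I] ->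
  (forall J, J #= `I_m -> eball s `<=` fam_closed_conv A' (~` J)) ->
  (forall i, (A i : set _) `<=` eball s \/
    exists2 j, g j = i & forall x, (A i : set _) x ->
      exists2 y, (A' j : set _) y & enorm (x - y) <= e) ->
  forall x, peeling m setT A x -> peeling m setT A' ((s / (s + e)) *: x).
Proof.
move=> s0 e0 mI sA' near x xA J [_ Jm].
have gJm : g @` J #<= `I_m.
  by rewrite -(card_le_eqr Jm); exact: card_image_le.
have [J' gJJ' J'm] := card_extend gJm mI.
rewrite setTD; have [clC cvC] := fam_closed_convP A' (~` J).
move: (sA' J Jm) clC cvC; rewrite -/(fam_closed_conv A' (~` J)).
set C := fam_closed_conv _ _ => sC clC cvC.
have := xA J' (conj (@subsetT _ _) J'm).
have se0 : 0 < s + e by rewrite addr_gt0.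
have k0 : 0 < s / (s + e) by rewrite divr_gt0.
apply: (@closed_conv_hull_min _ _ _ [set x | C ((s / (s + e)) *: x)]).
- apply/closed_enormP => y hy; apply: (closed_enormP _).1 clC _ _ => t t0.
  have [z Cz yz] := hy (t / (s / (s + e))) (divr_gt0 t0 k0).
  exists ((s / (s + e)) *: z) => //.
  by rewrite -scalerBr enormZ gtr0_norm// mulrC -ltr_pdivlMr.
- apply/convex_setP => y z a Cy Cz a01.
  rewrite /= (_ : _ *: _ = a *: ((s / (s + e)) *: y) +
    (1 - a) *: ((s / (s + e)) *: z)); last by apply/rowP => i; rewrite !mxE; ring.
  have cv := (@convex_setP _ _ C).1 cvC; exact: (cv _ _ a Cy Cz).
move=> y [i [_ J'i] Aiy] /=.
case: (near i) => [/(_ _ Aiy) ys|[j gj /(_ _ Aiy)[z A'z yz]]].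
  apply: sC; rewrite /eball/= enormZ gtr0_norm//.
  apply: le_trans ys; rewrite ler_piMl ?enorm_ge0//.
  by rewrite ler_pdivrMr// mul1r lerDl ltW.
apply: (scale_near_mem s0 e0 cvC sC _ yz).
apply: sub_fam_closed_conv A'z => Jj; apply: J'i.
by apply: gJJ'; exists j.
Qed.

End families.

(** * Comparing two families whose large sets are matched by [f] *)

Section matching.
Context {R : realType} {d : nat} {I I' : choiceType}.
Variables (A : I -> body R d) (A' : I' -> body R d) (m : nat).
Variables (F : set I) (f : I -> I') (r rho e M : R).
Hypotheses (r0 : 0 < r) (e0 : 0 < e) (er : e < r / 2) (rhor : rho <= r / 2).
Hypotheses (rhoM : rho <= M) (AM : forall i, body_norm (A i) <= M).
Hypothesis finF : finite_set F.
Hypothesis smallF : forall i, ~ F i -> body_norm (A i) <= rho.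
Hypothesis ballF : forall J, J #<= `I_m -> eball r `<=` fam_closed_conv A (F `\` J).
Hypothesis f_inj : {in F &, injective f}.
Hypothesis f_near : forall i, F i -> body_dist (A i) (A' (f i)) < e.
Hypothesis f_big : forall j, rho <= body_norm (A' j) -> exists2 i, F i & f i = j.

(** With fewer than [m] elements, [F] could be deleted entirely, and the hull of the empty family
    would contain a ball. *)
Lemma matching_card : `I_m #<= F.
Proof.
have [k Fk] := (finite_setP F).1 finF.
rewrite (card_le_eqr Fk) card_le_II leqNgt; apply/negP => km.
have Fm : F #<= `I_m by rewrite (card_le_eql Fk) card_le_II ltnW.
have : fam_closed_conv A (F `\` F) 0.
  by apply: ballF => //; rewrite /eball/= enorm0 ltW.
by rewrite setDv => /fam_closed_conv_nonempty[].
Qed.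

Lemma matching_cardT : `I_m #<= [set: I].
Proof. exact: card_le_trans matching_card (card_leT _). Qed.

Lemma matching_cardT' : `I_m #<= [set: I'].
Proof.
apply: card_le_trans (card_leT (f @` F)).
by rewrite (card_le_eqr (inj_card_eq f_inj)); exact: matching_card.
Qed.

Lemma matching_eball J : J #<= `I_m -> eball (r / 2) `<=` fam_closed_conv A (~` J).
Proof.
move=> Jm x xr; apply: (@fam_closed_convS _ _ _ _ (F `\` J)).
  by move=> i [].
by apply: ballF => //; apply: le_trans xr _; have := r0; lra.
Qed.

(** Since [f] is injective on [F], pulling [J] back to [F] gives at most [m] indices. The remaining
    bodies of [F] have partners outside [J] at distance below [e], so every point of [eball r] is
    within [r / 2] of the hull of [A'] without [J]; half the radius survives. *)
Lemma matching_eball' J : J #<= `I_m ->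
  eball (r / 2) `<=` fam_closed_conv A' (~` J).
Proof.
move=> Jm; pose J' := F `&` f @^-1` J.
have J'm : J' #<= `I_m.
  have fJ' : {in J' &, injective f}.
    by move=> i k /set_mem[Fi _] /set_mem[Fk _]; apply: f_inj; exact: mem_set.
  rewrite -(card_le_eql (inj_card_eq fJ')); apply: card_le_trans Jm.
  by apply: subset_card_le => _ [i [_ Ji] <-].
have [clC cvC] := fam_closed_convP A' (~` J).
have near x : (\bigcup_(i in F `\` J') (A i : set 'rV[R]_d)) x ->
    exists2 c, fam_closed_conv A' (~` J) c & enorm (x - c) <= e.
  move=> [i [Fi J'i] Aix]; have [y Ay xy] := body_dist_near (f_near Fi) Aix.
  by exists y => //; apply: sub_fam_closed_conv Ay => Jfi; exact: J'i.
have near' x : eball r x ->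
    exists2 c, fam_closed_conv A' (~` J) c & enorm (x - c) <= r / 2.
  move=> /(ballF J'm) xA.
  have [c Cc xc] := closed_conv_hull_near cvC near xA er.
  by exists c => //; exact: ltW.
have [|c Cc _] := near' 0; first by rewrite /eball/= enorm0 ltW.
have [j Jj] := fam_closed_conv_nonempty Cc.
apply: eball_sub_of_near => //; exact: sub_fam_closed_conv Jj (body0 _).
Qed.

Lemma scale_peeling x : peeling m setT A x ->
  peeling m setT A' ((r / 2 / (r / 2 + e)) *: x).
Proof.
have [i0 _] : F `\` set0 !=set0.
  apply: (@fam_closed_conv_nonempty _ _ _ A _ 0).
  by apply: ballF; rewrite ?card_ge0// /eball/= enorm0 ltW.
(* [g] inverts [f] on its image of [F]; elsewhere it takes the default value [i0], which cannot make
   the image of a deletion larger than the deletion. *)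
move: x; pose g j := xget i0 [set i | F i /\ f i = j].
apply: (peeling_scale (g := g)) => //; first by have := r0; lra.
- exact: matching_cardT.
- by move=> J Jm; apply: matching_eball'; rewrite (card_le_eql Jm).
move=> i; have [Fi|/smallF Fi] := pselect (F i); last first.
  left; apply: subset_trans (body_sub_eball (K := A i)) _.
  by move=> x xi; apply: le_trans xi _; apply: le_trans Fi _.
right; exists (f i); last exact: (body_dist_near (f_near Fi)).
have [Fg] : [set k | F k /\ f k = f i] (g (f i)) by apply: xgetPex; exists i.
by move=> fg; apply: f_inj => //; exact: mem_set.
Qed.

(** Here [f] itself carries the deletions. The bodies of [A'] of norm below [rho] lie in
    [eball (r / 2)], and all others are partners of bodies in [F]. *)
Lemma scale_peeling' x : peeling m setT A' x ->
  peeling m setT A ((r / 2 / (r / 2 + e)) *: x).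
Proof.
move: x; apply: (peeling_scale (g := f)) => //; first by have := r0; lra.
- exact: matching_cardT'.
- by move=> J Jm; apply: matching_eball; rewrite (card_le_eql Jm).
move=> j; have [/f_big[i Fi fij]|small] := leP rho (body_norm (A' j)); last first.
  left; apply: subset_trans (body_sub_eball (K := A' j)) _.
  by move=> x xj; apply: le_trans xj _; apply: le_trans (ltW small) _.
right; exists i => //; rewrite -fij; apply: (body_dist_near (e := e)).
by rewrite /body_dist hausdorff_distC; exact: f_near.
Qed.

Lemma matching_norm' j : body_norm (A' j) <= M + e.
Proof.
have [/f_big[i Fi <-]|small] := leP rho (body_norm (A' j)); last first.
  by have := rhoM; have := e0; lra.
have := body_norm_lip (A i) (A' (f i)); rewrite ler_norml => /andP[h _].
by have := f_near Fi; have := AM i; lra.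
Qed.

Lemma peeling_bounded (K : choiceType) (B : K -> body R d) N :
  `I_m #<= [set: K] -> (forall i, body_norm (B i) <= N) ->
  peeling m setT B `<=` eball N.
Proof.
move=> mK BN x xB.
have [J _ Jm] : exists2 J : set K, set0 `<=` J & J #= `I_m.
  by apply: card_extend => //; exact: card_ge0.
have := xB J (conj (@subsetT _ _) Jm); apply: closed_conv_hull_bounded => y [i _].
by move=> /body_sub_eball yi; exact: le_trans yi (BN i).
Qed.

(** By the two inclusions, scaling a point of one peeling gives a point of the other; with
    [s = r / 2], it moves the point by [e / (s + e)] times its norm, and norms are at most
    [M + e]. *)
Lemma hausdorff_dist_peeling :
  (0 <= hausdorff_dist (peeling m setT A') (peeling m setT A) <=
   (e / (r / 2) * (M + e))%:E)%E.
Proof.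
have s0 : 0 < r / 2 by have := r0; lra.
apply/andP; split.
  (* Between two empty sets the formula for the distance gives -oo; nonnegativity holds because the
     first peeling contains 0. *)
  have A'0 : peeling m setT A' 0.
    move=> J [_ Jm]; rewrite setTD; apply: matching_eball'.
      by rewrite (card_le_eql Jm).
    by rewrite /eball/= enorm0 ltW.
  rewrite /hausdorff_dist le_max; apply/orP; left.
  apply: (@le_trans _ _ (ereal_inf [set (enorm (0 - y))%:E | y in peeling m setT A])).
    by apply: le_ereal_inf_tmp => _ [y _ <-]; rewrite lee_fin enorm_ge0.
  by apply: ereal_sup_ubound; exists 0.
have near x : eball (M + e) x ->
    enorm (x - (r / 2 / (r / 2 + e)) *: x) <= e / (r / 2) * (M + e).
  move=> xM; rewrite -[X in X - _]scale1r -scalerBl enormZ.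
  have -> : 1 - r / 2 / (r / 2 + e) = e / (r / 2 + e).
    by field; rewrite gt_eqF//; have := r0; have := e0; lra.
  have se0 : 0 < r / 2 + e by rewrite addr_gt0.
  have k0 : 0 <= e / (r / 2 + e) by rewrite divr_ge0 ?ltW.
  rewrite ger0_norm//; apply: ler_pM => //; first exact: enorm_ge0.
  by rewrite ler_pM2l// lef_pV2 ?posrE// lerDl ltW.
apply/hausdorff_dist_leP => t ht; split=> x hx.
- exists ((r / 2 / (r / 2 + e)) *: x); first exact: scale_peeling'.
  apply: le_lt_trans ht; apply: near.
  exact: peeling_bounded matching_cardT' matching_norm' _ hx.
- exists ((r / 2 / (r / 2 + e)) *: x); first exact: scale_peeling.
  apply: le_lt_trans ht; apply: near.
  apply: peeling_bounded matching_cardT _ _ hx => i.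
  by apply: le_trans (AM i) _; rewrite lerDl ltW.
Qed.

End matching.

(** * Vague convergence *)

Lemma continuous_lipschitz {R : realType} (T : metricType R) (u : T -> R) k :
  (forall x y, `|u x - u y| <= k * mdist x y) -> continuous u.
Proof.
move=> uk x; apply/cvgrPdist_lt => e e0.
pose k1 := `|k| + 1.
have k0 : 0 < k1 by rewrite ltr_wpDl.
apply/nbhs_ballP; exists (e / k1) => /=; first exact: divr_gt0.
move=> y; rewrite ballEmdist /= => xy; apply: le_lt_trans (uk x y) _.
apply: (@le_lt_trans _ _ (k1 * mdist x y)).
  rewrite ler_wpM2r ?mdist_ge0//; apply: le_trans (ler_norm k) _.
  by rewrite lerDl.
by rewrite mulrC -ltr_pdivlMr.
Qed.

Section test_functions.
Context {R : realType} {d : nat}.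
Local Notation T := (body R d.+1).
Implicit Types (K L : T) (mu : {measure set T -> \bar R}) (u : T -> R).

Lemma continuous_body_lip k u : (forall K L, `|u K - u L| <= k * body_dist K L) ->
  continuous u.
Proof. by move=> uk; exact: (@continuous_lipschitz R T u k). Qed.

Lemma measurable_body_fun u : continuous u -> measurable_fun setT u.
Proof.
move=> /continuousP cu; apply: (measurability _ (RGenOpens.measurableE R)).
move=> _ [_ [a [b ->] <-]]; rewrite setTI.
by apply: sub_sigma_algebra; exact/cu/interval_open.
Qed.

(** A continuous [u] yields a continuous cutoff between the indicators of [1 <= u] and [0 < u]. *)
Definition test_fun u K : R := Num.max 0 (Num.min 1 (u K)).

Lemma continuous_test_fun u : continuous u -> continuous (test_fun u).
Proof.
move=> cu K; apply: (@continuous_max R _ (cst 0) (cst 1 \min u)).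
  exact: cst_continuous.
by apply: (@continuous_min R _ (cst 1) u); [exact: cst_continuous|exact: cu].
Qed.

Lemma test_fun_ge0 u K : 0 <= test_fun u K.
Proof. by rewrite le_max lexx. Qed.

Lemma measurable_ge1 u : measurable_fun setT u -> measurable [set K | 1 <= u K].
Proof.
move=> mfu; rewrite -[X in measurable X]setTI.
rewrite (_ : [set K | 1 <= u K] = u @^-1` `[1, +oo[); first exact: mfu.
by apply/seteqP; split=> K /=; rewrite in_itv/= andbT.
Qed.

Lemma measurable_gt0 u : measurable_fun setT u -> measurable [set K | 0 < u K].
Proof.
move=> mfu; rewrite -[X in measurable X]setTI.
rewrite (_ : [set K | 0 < u K] = u @^-1` `]0, +oo[); first exact: mfu.
by apply/seteqP; split=> K /=; rewrite in_itv/= andbT.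
Qed.

Lemma integral_test_fun mu u : continuous u ->
  (mu [set K | (1 <= u K)%R] <= \int[mu]_K (test_fun u K)%:E <=
   mu [set K | (0 < u K)%R])%E.
Proof.
move=> cu; have mu1 := measurable_ge1 (measurable_body_fun cu).
have mu0 := measurable_gt0 (measurable_body_fun cu).
have mtest : measurable_fun [set: T] (fun K => (test_fun u K)%:E).
  apply/measurable_EFinP; apply: measurable_body_fun.
  exact: continuous_test_fun.
have intE (U : set T) : measurable U -> (\int[mu]_K (\1_U K)%:E)%E = mu U.
  by move=> mU; rewrite integral_indic// setIT.
rewrite -(intE _ mu1) -(intE _ mu0).
apply/andP; split; apply: ge0_le_integral => //=.
- exact/measurable_EFinP/measurable_indic.
- move=> K _; rewrite lee_fin indicE; have [uK|_] := boolP (K \in _).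
    by rewrite /test_fun min_l ?max_r ?ler01//; exact: set_mem uK.
  exact: test_fun_ge0.
- by move=> K _; rewrite lee_fin test_fun_ge0.
- exact/measurable_EFinP/measurable_indic.
- move=> K _; rewrite lee_fin indicE; have [_|uK] := boolP (K \in _).
    by rewrite /test_fun ge_max ler01 ge_min lexx.
  rewrite /test_fun ge_max lexx ge_min; apply/orP; right.
  by rewrite leNgt; apply: contra uK => u0; exact: mem_set.
Qed.

Lemma vague_cvg_test_fun (mu_ : nat -> {measure set T -> \bar R}) mu u r :
  vague_cvg mu_ mu -> continuous u -> 0 < r ->
  (forall K, body_norm K < r -> u K <= 0) ->
  (\int[mu_ n]_K (test_fun u K)%:E @[n --> \oo] --> \int[mu]_K (test_fun u K)%:E)%E.
Proof.
move=> mu_cvg cu r0 ur; apply: mu_cvg.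
- exact: continuous_test_fun.
- exists 1; split; first exact: num_real.
  move=> M M1 K _ /=; rewrite ger0_norm ?test_fun_ge0//.
  apply: le_trans (ltW M1).
  by rewrite /test_fun ge_max ler01 ge_min lexx.
- exists r => // K; rewrite body_normE lte_fin => /ur uK.
  by rewrite /test_fun min_r ?max_l//; lra.
Qed.

(** This and the next lemma are the two halves of a portmanteau argument: the integrals of
    [test_fun u] converge and are squeezed between the measures of the two sets. *)
Lemma vague_cvg_lt (mu_ : nat -> {measure set T -> \bar R}) mu u r c :
  vague_cvg mu_ mu -> continuous u -> 0 < r ->
  (forall K, body_norm K < r -> u K <= 0) ->
  (mu [set K | (0 < u K)%R] < c)%E ->
  \forall n \near \oo, (mu_ n [set K | (1 <= u K)%R] < c)%E.
Proof.
move=> mu_cvg cu r0 ur muc.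
have /andP[_ le_mu] := integral_test_fun mu cu.
have cvg := vague_cvg_test_fun mu_cvg cu r0 ur.
have : \forall n \near \oo, (\int[mu_ n]_K (test_fun u K)%:E < c)%E.
  exact: cvg _ (open_ereal_lt' (le_lt_trans le_mu muc)).
apply: filterS => n.
by have /andP[+ _] := integral_test_fun (mu_ n) cu; exact: le_lt_trans.
Qed.

Lemma vague_cvg_gt (mu_ : nat -> {measure set T -> \bar R}) mu u r c :
  vague_cvg mu_ mu -> continuous u -> 0 < r ->
  (forall K, body_norm K < r -> u K <= 0) ->
  (c < mu [set K | (1 <= u K)%R])%E ->
  \forall n \near \oo, (c < mu_ n [set K | (0 < u K)%R])%E.
Proof.
move=> mu_cvg cu r0 ur muc.
have /andP[le_mu _] := integral_test_fun mu cu.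
have cvg := vague_cvg_test_fun mu_cvg cu r0 ur.
have : \forall n \near \oo, (c < \int[mu_ n]_K (test_fun u K)%:E)%E.
  exact: cvg _ (open_ereal_gt' (lt_le_trans muc le_mu)).
apply: filterS => n h.
by apply: lt_le_trans h _; have /andP[_ +] := integral_test_fun (mu_ n) cu.
Qed.

End test_functions.

(** * Counting bodies with sums of Dirac measures *)

Section sum_dirac.
Context {R : realType} {d : nat} {I : choiceType} (A : I -> body R d.+1).
Implicit Types (U : set (body R d.+1)).
Local Open Scope ereal_scope.

Lemma sum_dirac_ge_card (X : {fset I}) U : (forall i, i \in X -> U (A i)) ->
  (#|` X|)%:R%:E <= sum_dirac A U.
Proof.
move=> XU; apply: esum_ge; exists [set` X]; first by split.
rewrite fsbig_finite//= set_fsetK big_seq.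
rewrite (eq_bigr (fun=> 1)) => [|i iX]; last first.
  by rewrite diracE mem_set//; exact: XU.
by rewrite -big_seq big_const_seq count_predT iter_addr addr0 EFin_natmul.
Qed.

Lemma sum_dirac_le_card (X : {fset I}) U : (forall i, U (A i) -> i \in X) ->
  sum_dirac A U <= (#|` X|)%:R%:E.
Proof.
move=> UX; apply: (@le_trans _ _ (\esum_(i in [set` X]) 1)).
  rewrite /sum_dirac [leRHS]esum_mkcond; apply: le_esum => i _.
  rewrite diracE; have [iX|iX] := boolP (i \in [set` X]).
    by rewrite lee_fin; case: (_ \in _).
  rewrite memNset// => /UX iX'; move/negP: iX; apply; exact: mem_set.
rewrite esum_fset// fsbig_finite//= set_fsetK.
by rewrite big_const_seq count_predT iter_addr addr0 EFin_natmul.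
Qed.

(** Infinitely many such bodies would give infinite mass to the bodies of radius at least [e],
    because the norm of a body does not exceed its radius. *)
Lemma locally_finite_body_norm (e : R) : (0 < e)%R ->
  locally_finite (sum_dirac A) -> finite_set [set i | (e <= body_norm (A i))%R].
Proof.
move=> e0 /(_ e e0) lf; apply: contrapT => inf.
suff h : +oo <= sum_dirac A [set K | e%:E <= body_radius K].
  by have := le_lt_trans h lf; rewrite ltxx.
rewrite leye_eq; apply/eqP/eqyP => c c0.
have [k ck] : exists k : nat, (c <= k%:R)%R.
  by exists (Num.truncn c).+1; rewrite ltW// truncnS_gt.
have [X XI kX] := infinite_set_fset k inf.
apply: (@le_trans _ _ (#|` X|)%:R%:E).
  by rewrite lee_fin (le_trans ck)// ler_nat.
apply: sum_dirac_ge_card => i /XI /= ei; rewrite leNgt; apply/negP => re.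
have r0 : 0 <= body_radius (A i).
  by apply: ereal_sup_ubound; exists 0%R; rewrite ?enorm0//; exact: body0.
have rE : body_radius (A i) = (fine (body_radius (A i)))%:E.
  by rewrite fineK// ge0_fin_numE// (lt_trans re)// ltry.
move: re; rewrite rE lte_fin ltNge => /negP; apply; apply: le_trans ei _.
apply: body_norm_le => x Ax; rewrite /eball/= -lee_fin -rE.
by apply: ereal_sup_ubound; exists x.
Qed.

End sum_dirac.

Lemma near_finite (T : Type) (G : set_system T) (I : choiceType) (F : set I)
    (P : I -> T -> Prop) : Filter G -> finite_set F ->
  (forall i, F i -> \forall x \near G, P i x) ->
  \forall x \near G, forall i, F i -> P i x.
Proof.
move=> FG /finite_seqP[s ->]; elim: s => [|i s IH] Ps.
  by apply: filterE => x i.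
have /(filterI (Ps i (mem_head _ _))) : \forall x \near G, forall j, j \in s -> P j x.
  by apply: IH => j js; apply: Ps; rewrite /= inE js orbT.
apply: filterS => x [Pi Px] j /=; rewrite inE => /predU1P[->//|]; exact: Px.
Qed.

(** * From vague convergence to a matching of the large sets *)

Section vague_matching.
Context {R : realType} {d : nat}.

(** Mass near each [A i] with [i] in [F] provides a partner in [A_ n], and partners of distinct
    bodies are distinct. Conversely, an upper bound on the mass at norms slightly below [rho] allows
    at most as many bodies as [F] has elements, so the partners are the only candidates. *)
Lemma vague_matching (I_ : nat -> choiceType) (A_ : forall n, I_ n -> body R d.+1)
    (I : choiceType) (A : I -> body R d.+1) (rho e : R) :
  injective A -> locally_finite (sum_dirac A) ->
  vague_cvg (fun n => sum_dirac (A_ n)) (sum_dirac A) -> 0 < rho -> 0 < e ->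
  let F := [set i | rho <= body_norm (A i)] in F !=set0 ->
  \forall n \near \oo, exists f : I -> I_ n,
    [/\ {in F &, injective f},
        forall i, F i -> body_dist (A i) (A_ n (f i)) < e &
        forall j, rho <= body_norm (A_ n j) -> exists2 i, F i & f i = j].
Proof.
move=> A_inj A_lf A_cvg rho0 e0 F [i0 Fi0].
have finF : finite_set F by exact: locally_finite_body_norm.
(* Only finitely many norms lie in [[rho / 2, rho)], so there is a gap just below [rho] free of
   norms of [A]. *)
have [g g0 gap] : exists2 g, 0 < g <= rho / 2 &
    forall i, rho - g < body_norm (A i) -> F i.
  have [|i [_ ?]|g g0 hg] := @finite_lower_bound _ R (fun i => rho - body_norm (A i))
      [set i | rho / 2 <= body_norm (A i) /\ body_norm (A i) < rho].
  - apply: sub_finite_set (locally_finite_body_norm (e := rho / 2) _ A_lf).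
      by move=> i [].
    by lra.
  - by rewrite subr_gt0.
  exists (Num.min g (rho / 2)).
    by rewrite lt_min g0 ge_min lexx orbT andbT; lra.
  have [gl gr] : Num.min g (rho / 2) <= g /\ Num.min g (rho / 2) <= rho / 2.
    by rewrite !ge_min !lexx orbT.
  move=> i h; rewrite /F/= leNgt; apply/negP => ir.
  have [ir2|] := leP (rho / 2) (body_norm (A i)); last by lra.
  by have := hg i (conj ir2 ir); lra.
have [s s0 sep] : exists2 s, 0 < s &
    forall i k, F i -> F k -> i != k -> s <= body_dist (A i) (A k).
  have [||s s0 hs] := @finite_lower_bound _ R
      (fun p : I * I => body_dist (A p.1) (A p.2))
      [set p | (F `*` F) p /\ p.1 != p.2].
  - by apply: sub_finite_set (finite_setX finF finF) => p [].
  - move=> [i k] [_ /= ik]; have := @mdist_gt0 R (body R d.+1) (A i) (A k).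
    by move=> ->; apply: contra ik => /eqP/A_inj ->.
  by exists s => // i k Fi Fk ik; apply: (hs (i, k)).
have rho2 : 0 < rho / 2 by lra.
(* The bound [g / 2] keeps the norms of partners above [rho - g / 2]; the bound [s / 2] makes
   partners of different bodies different. *)
pose t := Num.min e (Num.min (g / 2) (s / 2)).
have [t0 te tg ts] : [/\ 0 < t, t <= e, t <= g / 2 & t <= s / 2].
  rewrite /t !lt_min !ge_min !lexx ?orbT; split => //; lra.
have distC (K L : body R d.+1) : body_dist K L = body_dist L K.
  by rewrite /body_dist hausdorff_distC.
have distxx (K : body R d.+1) : body_dist K K = 0.
  exact: (@mdistxx R (body R d.+1)).
have distD (K L N : body R d.+1) : body_dist K N <= body_dist K L + body_dist L N.
  exact: (@metric_triangle R (body R d.+1)).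
have near_atom : \forall n \near \oo, forall i, F i ->
    exists j, body_dist (A i) (A_ n j) < t.
  apply: near_finite => // i Fi.
  (* [u] is 1 at [A i] and positive exactly at distance less than [t]; bodies of norm below
     [rho / 2] are farther away. *)
  pose u K := 1 - body_dist K (A i) / t.
  have cu : continuous u.
    apply: (@continuous_body_lip R d t^-1) => K L.
    have -> : u K - u L = t^-1 * (body_dist L (A i) - body_dist K (A i)).
      by rewrite /u; ring.
    rewrite normrM ger0_norm ?invr_ge0 ?(ltW t0)// ler_pM2l ?invr_gt0//.
    rewrite ler_norml; have := distD L K (A i); have := distD K L (A i).
    by rewrite (distC L K); lra.
  have u_small K : body_norm K < rho / 2 -> u K <= 0.
    move=> Kr; rewrite subr_le0 ler_pdivlMr// mul1r.
    have := body_norm_lip K (A i); rewrite ler_norml => /andP[].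
    by move: Fi; rewrite /F/=; lra.
  have : (0 < sum_dirac A [set K | (1 <= u K)%R])%E.
    apply: (@lt_le_trans _ _ (#|` [fset i]%fset|%:R)%:E).
      by rewrite cardfs1 lte_fin ltr01.
    apply: sum_dirac_ge_card => k; rewrite inE => /eqP ->; rewrite /u/=.
    by rewrite distxx mul0r subr0.
  move=> /(vague_cvg_gt A_cvg cu rho2 u_small); apply: filterS => n un.
  apply: contrapT => /forallNP no; move: un; rewrite ltNge => /negP; apply.
  have := @sum_dirac_le_card _ _ _ (A_ n) fset0 [set K | (0 < u K)%R].
  rewrite cardfs0; apply => j uj; exfalso; apply: (no j).
  by move: uj; rewrite /u/= subr_gt0 ltr_pdivrMr// mul1r distC.
pose N := #|` fset_set F|.
have near_count : \forall n \near \oo, forall X : {fset I_ n},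
    (forall j, j \in X -> rho - g / 2 <= body_norm (A_ n j)) -> (#|` X| <= N)%N.
  (* [u] is positive for norms above [rho - g], which among the sets of [A] means membership in [F],
     and reaches 1 at norm [rho - g / 2]. *)
  pose u (K : body R d.+1) := (body_norm K - (rho - g)) / (g / 2).
  have cu : continuous u.
    apply: (@continuous_body_lip R d (g / 2)^-1) => K L.
    have -> : u K - u L = (g / 2)^-1 * (body_norm K - body_norm L).
      by rewrite /u; ring.
    rewrite normrM ger0_norm ?ler_pM2l ?invr_gt0 ?invr_ge0; last by lra.
      exact: body_norm_lip.
    by lra.
  have u_small K : body_norm K < rho / 2 -> u K <= 0.
    by move=> Kr; rewrite /u pmulr_lle0 ?invr_gt0; lra.
  have : (sum_dirac A [set K | (0 < u K)%R] < N.+1%:R%:E)%E.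
    apply: (@le_lt_trans _ _ N%:R%:E); last by rewrite lte_fin ltr_nat.
    apply: sum_dirac_le_card => i; rewrite /= in_fset_set// => ui.
    apply/mem_set/gap; rewrite -subr_gt0.
    by move: ui; rewrite /u pmulr_lgt0 ?invr_gt0//; lra.
  move=> /(vague_cvg_lt A_cvg cu rho2 u_small); apply: filterS => n un.
  move=> X XA; rewrite -ltnS -(ltr_nat R) -lte_fin; apply: le_lt_trans un.
  apply: sum_dirac_ge_card => j /XA; rewrite /u/= ler_pdivlMr ?mul1r; lra.
near=> n.
have atomn : forall i, F i -> exists j, body_dist (A i) (A_ n j) < t.
  by near: n.
have countn : forall X : {fset I_ n},
    (forall j, j \in X -> rho - g / 2 <= body_norm (A_ n j)) -> (#|` X| <= N)%N.
  by near: n.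
have [j0 _] := atomn _ Fi0.
have /choice[f hf] : forall i, exists j, F i -> body_dist (A i) (A_ n j) < t.
  move=> i; have [/atomn[j hj]|nF] := pselect (F i); last by exists j0.
  by exists j.
have f_inj : {in F &, injective f}.
  move=> i k /set_mem Fi /set_mem Fk fik; apply/eqP/negPn/negP => ik.
  have := sep i k Fi Fk ik; have := distD (A i) (A_ n (f i)) (A k).
  by have := hf i Fi; have := hf k Fk; rewrite -fik distC; lra.
exists f; split => // [i Fi|j jr]; first exact: lt_le_trans (hf i Fi) te.
apply: contrapT => nofj.
(* The [N] partners together with an unmatched [j] would be [N + 1] bodies of norm at least
   [rho - g / 2]. *)
have finfF : finite_set (f @` F) by exact: finite_image.
have cardfF : #|` fset_set (f @` F)| = N.
  by apply/fcard_eq => //; exact: inj_card_eq.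
have : (#|` (j |` fset_set (f @` F))%fset| <= N)%N.
  apply: countn => k; rewrite !inE => /predU1P[->|]; first by lra.
  rewrite in_fset_set// => /set_mem[i iF <-].
  have := body_norm_lip (A i) (A_ n (f i)); rewrite ler_norml => /andP[_].
  by have := hf i iF; move: iF; rewrite /F/=; lra.
rewrite cardfsU1 in_fset_set// memNset; last first.
  by move=> [i iF fi]; apply: nofj; exists i.
by rewrite cardfF add1n ltnn.
Unshelve. all: by end_near.
Qed.

End vague_matching.

(** * Convergence of the peelings *)

Theorem theorem4p2 (R : realType) (d : nat)
  (I_ : nat -> choiceType) (A_ : forall n, I_ n -> body R d.+1)
  (I : choiceType) (A : I -> body R d.+1) (m : nat)
  (A_inj : forall n, injective (A_ n))
  (A_lf : forall n, locally_finite (sum_dirac (A_ n)))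
  (Ainj : injective A) (Alf : locally_finite (sum_dirac A))
  (A_cvg : vague_cvg (fun n => sum_dirac (A_ n)) (sum_dirac A))
  (A_regular : \forall n \near \oo, forall K : body R d.+1,
     atom (sum_dirac (A_ n)) K -> strictly_convex K /\ regular_body K)
  (A_gp : general_position_cofinitely [set: I] A)
  (A_int : forall F : set I, finite_set F -> (fam_conv ([set: I] `\` F) A)° 0) :
  hausdorff_dist (peeling m [set: I_ n] (A_ n)) (peeling m [set: I] A)
    @[n --> \oo] --> 0%E.
Proof.
have A_fin e : 0 < e -> finite_set [set i | e <= body_norm (A i)].
  by move=> e0; exact: locally_finite_body_norm.
have A_intC F : finite_set F -> (fam_conv (~` F) A)° 0.
  by move=> /A_int; rewrite setTD.
have [r r0 [G finG ballG]] := eball_fam_closed_convD m A_fin A_intC.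
(* The threshold is low enough to keep all of [G], and at most [r / 2], so that smaller bodies lie
   in the ball contained in every hull. *)
have [rho [rho0 rhor Grho]] : exists rho, [/\ 0 < rho, rho <= r / 2 &
    forall i, G i -> rho <= body_norm (A i)].
  have [||e e0 he] := @finite_lower_bound _ R (fun i => body_norm (A i)) G => //.
    by move=> i _; exact: body_norm_gt0.
  exists (Num.min e (r / 2)); split; first by rewrite lt_min e0; lra.
    by rewrite ge_min lexx orbT.
  by move=> i Gi; rewrite ge_min he.
(* Finitely many norms are at least 1; a positive lower bound on their inverses bounds them from
   above. *)
have [M rhoM AM] : exists2 M, rho <= M & forall i, body_norm (A i) <= M.
  have [||e e0 he] := @finite_lower_bound _ R (fun i => (body_norm (A i))^-1)
      [set i | 1 <= body_norm (A i)].
  - exact: A_fin.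
  - by move=> i _; rewrite invr_gt0 body_norm_gt0.
  have eV0 : 0 < e^-1 by rewrite invr_gt0.
  exists (1 + e^-1 + rho); first by lra.
  move=> i; have [/he|] := leP 1 (body_norm (A i)); last by lra.
  by rewrite -lef_pV2 ?posrE ?invr_gt0 ?body_norm_gt0// invrK; lra.
pose F := [set i | rho <= body_norm (A i)].
have ballF J : J #<= `I_m -> eball r `<=` fam_closed_conv A (F `\` J).
  move=> Jm; apply: subset_trans (ballG J Jm) (fam_closed_convS _).
  by move=> i [Gi Ji]; split => //; exact: Grho.
have F0 : F !=set0.
  have [|i [Fi _]] := @fam_closed_conv_nonempty _ _ _ A (F `\` set0) 0.
    by apply: ballF; rewrite ?card_ge0// /eball/= enorm0 ltW.
  by exists i.
have M0 : 0 < M by exact: lt_le_trans rho0 rhoM.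
have bound e : 0 < e -> e < r / 2 -> \forall n \near \oo,
    (0 <= hausdorff_dist (peeling m [set: I_ n] (A_ n)) (peeling m [set: I] A)
       <= (e / (r / 2) * (M + e))%:E)%E.
  move=> e0 er; have := vague_matching Ainj Alf A_cvg rho0 e0 F0.
  apply: filterS => n [f [f_inj f_near f_big]].
  apply: (hausdorff_dist_peeling (F := F) (f := f) (rho := rho)) => //.
    exact: A_fin.
  by move=> i Fi; rewrite leNgt; apply/negP => /ltW.
apply/fine_cvgP; split.
  have := bound (r / 4) ltac:(lra) ltac:(lra); apply: filterS => n /andP[h0 h1].
  by rewrite ge0_fin_numE// (le_lt_trans h1)// ltry.
apply/cvgrPdist_le => eta eta0.
(* As [e <= 1], the error is at most [e * (M + 1) / (r / 2)], hence at most [eta]; the bound [r / 4]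
   ensures [e < r / 2]. *)
pose e := Num.min (Num.min 1 (r / 4)) (eta * (r / 2) / (M + 1)).
have r20 : 0 < r / 2 by lra.
have [e0 e1 er ee] : [/\ 0 < e, e <= 1, e <= r / 4 & e <= eta * (r / 2) / (M + 1)].
  have r40 : 0 < r / 4 by lra.
  rewrite /e !lt_min !ge_min !lexx ?orbT ltr01 r40; split => //.
  by rewrite divr_gt0 ?mulr_gt0 ?addr_gt0.
have := bound e e0 ltac:(lra); apply: filterS => n /andP[h0 h1].
rewrite /= sub0r normrN ger0_norm ?fine_ge0// -lee_fin fineK; last first.
  by rewrite ge0_fin_numE// (le_lt_trans h1)// ltry.
apply: le_trans h1 _; rewrite lee_fin mulrAC ler_pdivrMr//.
apply: (@le_trans _ _ (e * (M + 1))); first by rewrite ler_pM2l// lerD2l.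
by rewrite -ler_pdivlMr// addr_gt0.
Qed.
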